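(* Let $G=(V,E)$ be a finite oriented graph and let $k,l$ be positive integers. Then $t_G(1+l,1+k)$ equals the number of triples $(f,t,\sigma)$ such that (i) $f$ is a $\mathbb{Z}_k$-flow on $G$ and $t$ is a $\mathbb{Z}_l$-tension on $G$ (neither required to be nowhere-zero), (ii) $\operatorname{supp}(f)\cap\operatorname{supp}(t)=\emptyset$, and (iii) $\sigma\subseteq E\setminus(\operatorname{supp}(f)\cup\operatorname{supp}(t))$ is an arbitrary subset (a reorientation of $G_{\setminus(\operatorname{supp}(f)\cup\operatorname{supp}(t))}$).
   Context: Oriented graphs may have loops and multiple edges. $t_G(x,y)$ is the Tutte polynomial of (the underlying undirected graph of) $G$. A $\mathbb{Z}_k$-flow is a map $f:E\to\mathbb{Z}_k$ such that at each vertex the sum of values on entering edges minus the sum on leaving edges is $0$. For an undirected cycle $C\subseteq E$ (including loops and pairs of parallel edges), let $C_-\subseteq C$ be a set of edges whose reversal makes $C$ a directed cycle and $C_+=C\setminus C_-$. A $\mathbb{Z}_l$-tension is a map $t:E\to\mathbb{Z}_l$ with $\sum_{e\in C_+}t(e)-\sum_{e\in C_-}t(e)=0$ for every undirected cycle $C$ (independent of the choice of $C_-$). Supports: $\operatorname{supp}(g)=\{e: g(e)\ne0\}$. $G_{\setminus S}$ denotes deletion of the edges in $S$. *)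

(* Defs.v *)
From mathcomp Require Export all_boot all_order all_algebra.
From mathcomp Require Export polyXY.

Set Implicit Arguments.
Unset Strict Implicit.
Unset Printing Implicit Defensive.

Import GRing.Theory.
Global Open Scope ring_scope.

(* The edge e is oriented from [src e] to [tgt e].  Nothing forbids loops
   ([src e = tgt e]) or several edges with the same ends. *)
Record ograph := OGraph {
  vertex : finType;
  edge : finType;
  src : edge -> vertex;
  tgt : edge -> vertex
}.

(* Z/kZ for k > 0.  Unlike ['Z_k], which is Z/2Z for k = 1, this is the trivial
   group for k = 1; it only carries the additive group structure. *)
Notation Zmod k := ('I_(k.-1.+1)) (only parsing).

Section OrientedGraph.

Variable G : ograph.
Implicit Types (v : vertex G) (e : edge G) (A C M : {set edge G}).

Definition adj A : rel (vertex G) :=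
  [rel u v | [exists e in A,
     ((src e == u) && (tgt e == v)) || ((src e == v) && (tgt e == u))]].

Definition ncomp A : nat := n_comp (adj A) predT.

Definition grank A : nat := (#|vertex G| - ncomp A)%N.

Definition gnullity A : nat := (#|A| - grank A)%N.

(* Rank-nullity (Whitney) expansion. *)
Definition tutte : {poly {poly int}} :=
  \sum_(A : {set edge G})
     ('X - 1) ^+ (grank setT - grank A)%N * ('Y - 1) ^+ gnullity A.

Definition reverse M : ograph :=
  @OGraph (vertex G) (edge G)
    (fun e => if e \in M then tgt e else src e)
    (fun e => if e \in M then src e else tgt e).

(* The edges of C can be listed as e_1, ..., e_n (n >= 1) with e_i ending where
   e_(i+1) starts (cyclically) and no vertex visited twice; n = 1 is a loop. *)
Definition directed_cycle C : bool :=
  (C != set0) &&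
  [exists s : #|C|.-tuple (edge G),
     [&& [set e in s] == C,
         uniq [seq src e | e <- s] &
         cycle [rel e e' | tgt e == src e'] s]].

End OrientedGraph.

Section FlowsTensions.

Variables (G : ograph) (B : zmodType).
Implicit Types (f t : {ffun edge G -> B}) (C M : {set edge G}).

Definition supp f : {set edge G} := [set e | f e != 0].

Definition is_flow f : bool :=
  [forall v : vertex G,
     \sum_(e | tgt e == v) f e - \sum_(e | src e == v) f e == 0].

(* C ranges over the undirected cycles and M over all possible choices of C_-:
   C is an undirected cycle exactly when some such M exists. *)
Definition is_tension t : bool :=
  [forall C : {set edge G}, forall M : {set edge G},
     (M \subset C) && @directed_cycle (reverse M) C ==>
     (\sum_(e in C :\: M) t e - \sum_(e in M) t e == 0)].

End FlowsTensions.

(* Main.v *)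
(* The Whitney expansion at (1 + l, 1 + k) is the sum over A of
    l ^ (r(E) - r(A)) * k ^ n(A).  The second factor counts the Z_k-flows
    supported in A: the boundary map sends functions supported in A onto the
    vertex functions with zero sum on each component of (V, A).  The first one
    counts the Z_l-tensions vanishing on A: tensions are the coboundaries of
    vertex potentials, and those vanishing on A come from potentials constant on
    the components of (V, A).  Finally (f, t, sigma) corresponds to (f, t, A)
    with A = supp f + sigma. *)

Require Import Defs.
From mathcomp Require Import zify.

Set Implicit Arguments.
Unset Strict Implicit.
Unset Printing Implicit Defensive.

Import GRing.Theory.

(** * Counting by fibres, and lists with repetitions or cyclic order *)

Lemma card_uniform_fibers (X Y : finType) (D : {set X}) (g : X -> Y) (m : nat) :
  {in D, forall x0, #|[set x in D | g x == g x0]| = m} ->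
  #|D| = (#|g @: D| * m)%N.
Proof.
move=> hm; rewrite -sum1_card (partition_big_imset g) /=.
rewrite -sum_nat_const; apply: eq_bigr => _ /imsetP [x0 x0D ->].
by rewrite -(hm _ x0D) -sum1dep_card; apply: eq_bigl => x.
Qed.

(* The fibers of an additive map over its image are translates of its kernel;
   the subgroup is given as a set so that subsets of functions are covered. *)
Lemma card_additive_image (I J : finType) (B : finZmodType)
    (D : {set {ffun I -> B}}) (g : {ffun I -> B} -> {ffun J -> B}) :
  {in D &, forall x y, x + y \in D} -> {in D, forall x, - x \in D} ->
  {morph g : x y / x + y} ->
  #|D| = (#|g @: D| * #|[set x in D | g x == 0%R]|)%N.
Proof.
move=> DD DN gD; apply: card_uniform_fibers => x0 x0D.
rewrite -(card_imset _ (addIr (- x0))); congr #|pred_of_set _|.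
have gN x : g (- x) = - g x.
  have g0 : g 0 = 0 by apply: (addIr (g 0)); rewrite -gD !add0r.
  by apply: (addIr (g x)); rewrite -gD !addNr.
apply/setP => y; apply/imsetP/idP => [[x + ->]|].
  rewrite !inE => /andP[xD /eqP gx].
  by rewrite gD gN gx subrr eqxx DD ?DN.
rewrite inE => /andP[yD /eqP gy]; exists (y + x0); last by rewrite addrK.
by rewrite inE DD //= gD gy add0r.
Qed.

(** Supplies the two places at which a closed walk is cut when it repeats a vertex or an edge. *)
Lemma not_uniq_map_split (T : Type) (U : eqType) (f : T -> U) (s : seq T) :
  ~~ uniq (map f s) ->
  exists s1 x s2 y s3, s = s1 ++ x :: s2 ++ y :: s3 /\ f x = f y.
Proof.
elim: s => [//|x s IH] /=; rewrite negb_and negbK => /orP[xs|/IH].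
  suff [s2 [y [s3 [-> e]]]] : exists s2 y s3, s = s2 ++ y :: s3 /\ f x = f y.
    by exists [::], x, s2, y, s3.
  elim: s xs {IH} => [//|z s IH] /=; rewrite inE => /predU1P[->|/IH].
    by exists [::], z, s.
  by case=> s2 [y [s3 [-> ->]]]; exists (z :: s2), y, s3.
by case=> s1 [y [s2 [z [s3 [-> e]]]]]; exists (x :: s1), y, s2, z, s3.
Qed.

Lemma uniq_map_inj_in (T U : eqType) (f : T -> U) (s : seq T) :
  uniq (map f s) -> {in s &, injective f}.
Proof.
elim: s => [//|x s IH] /= /andP[nx /IH inj] y z.
rewrite !inE => /predU1P[->|ys] /predU1P[->|zs] // fE; last exact: inj.
  by case/negP: nx; rewrite fE map_f.
by case/negP: nx; rewrite -fE map_f.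
Qed.

(** Around a cycle each head is the next tail; this is what makes sums of potential differences
    telescope. *)
Lemma cycle_map_rot1 (T : Type) (U : eqType) (a b : T -> U) (s : seq T) :
  cycle [rel x y | b x == a y] s -> map b s = rot 1 (map a s).
Proof.
case: s => [//|x0 s] /=; rewrite rot1_cons.
(* The closing element [x0] stays fixed while the start of the path varies, so that induction
   applies. *)
suff H x : path [rel x y | b x == a y] x (rcons s x0) ->
    b x :: map b s = rcons (map a s) (a x0) by exact: H.
elim: s x => [|y s IH] x /=; first by rewrite andbT => /eqP ->.
by move=> /andP[/eqP -> /IH ->].
Qed.

(** * Connected components of [(V, A)] and their roots *)

Section Components.

Variables (G : ograph) (A : {set edge G}).

Lemma adj_connect_sym : connect_sym (adj A).
Proof.
apply: sym_connect_sym => u v /=.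
by apply: eq_existsb => e; rewrite orbC.
Qed.

Lemma root_edge e : e \in A -> fingraph.root (adj A) (src e) = fingraph.root (adj A) (tgt e).
Proof.
move=> eA; apply/(fingraph.rootP adj_connect_sym); apply: connect1 => /=.
by apply/existsP; exists e; rewrite eA !eqxx.
Qed.

Lemma ncomp_leq : (ncomp A <= #|vertex G|)%N.
Proof. exact: max_card. Qed.

(** A model of one free value of [B] per component, kept inside the functions on all vertices. *)
Definition root_supported (B : finZmodType) : {set {ffun vertex G -> B}} :=
  [set g : {ffun vertex G -> B} | [forall v, (g v != 0) ==> (v \in roots (adj A))]].

Lemma card_root_supported (B : finZmodType) :
  #|root_supported B| = (#|B| ^ ncomp A)%N.
Proof.
transitivity #|pffun_on (0 : B) [predI roots (adj A) & predT] (predT : pred B)|;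
  last by rewrite card_pffun_on.
apply: eq_card => g; rewrite inE; apply/forallP/pffun_onP => [h|[h _] v].
  split=> [|//]; apply/subsetP => v; rewrite !inE => gv.
  by have /implyP/(_ gv) := h v; rewrite andbT.
by apply/implyP => gv; have := subsetP h v; rewrite !inE andbT; apply.
Qed.

End Components.

(** * Counting flows supported in [A] *)

Section FlowCount.

Variables (G : ograph) (B : finZmodType) (A : {set edge G}).
Implicit Types (f : {ffun edge G -> B}) (d : {ffun vertex G -> B}).

Definition boundary f : {ffun vertex G -> B} :=
  [ffun v => \sum_(e | tgt e == v) f e - \sum_(e | src e == v) f e].

Lemma is_flowE f : is_flow f = (boundary f == 0).
Proof.
apply/forallP/eqP => [h|h v]; first by apply/ffunP => v; rewrite !ffunE; apply/eqP.
by have /ffunP/(_ v) := h; rewrite !ffunE => ->.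
Qed.

Lemma boundaryD : {morph boundary : f g / f + g}.
Proof.
move=> f g; apply/ffunP => v; rewrite !ffunE.
under eq_bigr do rewrite ffunE; under [X in _ - X]eq_bigr do rewrite ffunE.
by rewrite !big_split /= opprD addrACA.
Qed.

(** The sum over a component is stored at its root; at other vertices the sum is empty. *)
Definition component_sum d : {ffun vertex G -> B} :=
  [ffun r => \sum_(v | fingraph.root (adj A) v == r) d v].

Lemma component_sumD : {morph component_sum : d d' / d + d'}.
Proof.
move=> d d'; apply/ffunP => r; rewrite !ffunE -big_split.
by apply: eq_bigr => v _; rewrite ffunE.
Qed.

Definition supported : {set {ffun edge G -> B}} := [set f | supp f \subset A].

Lemma supportedP f : reflect (forall e, e \notin A -> f e = 0) (f \in supported).
Proof.
rewrite inE; apply: (iffP subsetP) => [h e|h e].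
  by apply: contraNeq => fe; apply: h; rewrite inE.
by rewrite inE; apply: contraNT => /h ->.
Qed.

Lemma supportedD : {in supported &, forall f g, f + g \in supported}.
Proof.
move=> f g /supportedP hf /supportedP hg; apply/supportedP => e eA.
by rewrite ffunE hf ?hg ?addr0.
Qed.

Lemma supportedN : {in supported, forall f, - f \in supported}.
Proof.
move=> f /supportedP hf; apply/supportedP => e eA.
by rewrite ffunE hf ?oppr0.
Qed.

Lemma card_supported : #|supported| = (#|B| ^ #|A|)%N.
Proof.
transitivity #|pffun_on (0 : B) A (predT : pred B)|; last by rewrite card_pffun_on.
apply: eq_card => f.
rewrite inE; apply/subsetP/pffun_onP => [h|[h _] v].
  by split=> //; apply/subsetP => v fv; apply: h; rewrite inE.
by rewrite inE => fv; apply: (subsetP h).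
Qed.

Definition dirac (u : vertex G) (b : B) : {ffun vertex G -> B} :=
  [ffun v => if v == u then b else 0].

Lemma boundary_edge e b :
  boundary [ffun e' => if e' == e then b else 0] = dirac (tgt e) b - dirac (src e) b.
Proof.
apply/ffunP => v; rewrite !ffunE.
have E (h : edge G -> vertex G) :
    \sum_(e' | h e' == v) [ffun e' => if e' == e then b else 0] e' =
    (if v == h e then b else 0).
  rewrite big_mkcond (bigD1 e) //= ffunE eqxx eq_sym big1 ?addr0 //.
  by move=> e' /negPf ne; rewrite ffunE ne if_same.
by rewrite !E.
Qed.

Lemma boundary_supportedD x y :
  x \in boundary @: supported -> y \in boundary @: supported ->
  x + y \in boundary @: supported.
Proof.
move=> /imsetP[f fA ->] /imsetP[g gA ->].
by rewrite -boundaryD imset_f // supportedD.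
Qed.

Lemma boundary_supported0 : 0 \in boundary @: supported.
Proof.
apply/imsetP; exists 0; first by apply/supportedP => e _; rewrite ffunE.
by apply: (addIr (boundary 0)); rewrite -boundaryD !add0r.
Qed.

(** Sending [b] along a path from [u] to [v] telescopes; an edge traversed backwards carries
    [- b]. *)
Lemma boundary_dirac_connect u v b : connect (adj A) u v ->
  dirac v b - dirac u b \in boundary @: supported.
Proof.
have step e c : e \in A -> dirac (tgt e) c - dirac (src e) c \in boundary @: supported.
  move=> eA; rewrite -boundary_edge imset_f //; apply/supportedP => e' e'A.
  by rewrite ffunE; case: eqP => // ee; rewrite ee eA in e'A.
have diracN w c : dirac w (- c) = - dirac w c.
  by apply/ffunP => x; rewrite !ffunE; case: ifP => //; rewrite oppr0.
move/connectP => [p pth ->] {v}; elim: p u pth => [|w p IH] u /=.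
  by rewrite subrr boundary_supported0.
move=> /andP[/existsP[e /andP[eA ends]] /IH pw].
rewrite -[dirac (last w p) b](subrK (dirac w b)) -addrA; apply: boundary_supportedD => //.
case/orP: ends => /andP[/eqP<- /eqP<-]; first exact: step.
by have := step e (- b) eA; rewrite !diracN opprK addrC.
Qed.

(** An edge of [A] has both ends in one component, so its contributions cancel. Conversely, zero
    component sums allow [d] to be assembled from transfers between roots and vertices. The right
    side has the shape of the kernel in [card_additive_image]. *)
Lemma boundary_image :
  boundary @: supported = [set d in setT | component_sum d == 0].
Proof.
apply/setP => d; rewrite !inE /=; apply/imsetP/eqP => [[f /supportedP fA ->]|hd].
  apply/ffunP => r; rewrite !ffunE.
  under eq_bigr do rewrite ffunE.
  rewrite big_split /= sumrN.
  have E (h : edge G -> vertex G) :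
      \sum_(v | fingraph.root (adj A) v == r) \sum_(e | h e == v) f e
      = \sum_(e | fingraph.root (adj A) (h e) == r) f e.
    rewrite [RHS](partition_big h (fun v => fingraph.root (adj A) v == r)) //=.
    apply: eq_bigr => v /eqP rv; apply: eq_bigl => e.
    by case: eqP => [->|]; rewrite ?rv ?eqxx // andbF.
  rewrite !E; apply/eqP; rewrite subr_eq0; apply/eqP.
  rewrite big_mkcond [RHS]big_mkcond; apply: eq_bigr => e _.
  case: (boolP (e \in A)) => [eA|/fA ->]; last by rewrite !if_same.
  by rewrite root_edge.
suff: d \in boundary @: supported by move/imsetP.
(* The subtracted terms collect at each [r] the component sum of [d] there, which is zero. *)
have -> : d = \sum_v (dirac v (d v) - dirac (fingraph.root (adj A) v) (d v)).
  rewrite sumrB; apply/ffunP => r; rewrite !ffunE !sum_ffunE.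
  have /ffunP/(_ r) := hd; rewrite !ffunE => cr.
  rewrite (bigD1 r) //= ffunE eqxx big1 => [|v vr]; last first.
    by rewrite ffunE eq_sym (negPf vr).
  rewrite addr0; suff -> : \sum_v dirac (fingraph.root (adj A) v) (d v) r = 0 by rewrite subr0.
  by rewrite -[RHS]cr [RHS]big_mkcond; apply: eq_bigr => v _; rewrite ffunE eq_sym.
elim/big_ind: _ => [|x y|v _]; [exact: boundary_supported0|exact: boundary_supportedD|].
by apply: boundary_dirac_connect; rewrite adj_connect_sym connect_root.
Qed.

(** A function supported on roots is its own component sum, since each component has only one
    root. *)
Lemma component_sum_image : component_sum @: setT = root_supported A B.
Proof.
apply/setP => g; rewrite inE; apply/imsetP/forallP => [[d _ ->] v|h].
  apply/implyP; apply: contraR => nr; rewrite ffunE big1 // => u /eqP ru.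
  by case/negP: nr; rewrite -ru; apply: roots_root; apply: adj_connect_sym.
exists g => //; apply/ffunP => r; rewrite ffunE.
have E v : g v = if v \in roots (adj A) then g v else 0.
  by case: ifPn => // nv; apply/eqP; apply: contraNT nv => /(implyP (h v)).
have rE v : v \in roots (adj A) -> fingraph.root (adj A) v = v by move/eqP.
case: (boolP (r \in roots (adj A))) => rr; last first.
  rewrite E (negPf rr) big1 // => u /eqP ru.
  by case/negP: rr; rewrite -ru; apply: roots_root; apply: adj_connect_sym.
rewrite (bigD1 r) /=; last by rewrite rE.
rewrite big1 ?addr0 // => u /andP[/eqP ru ur].
by rewrite E; case: ifP => // /rE uE; rewrite -uE ru eqxx in ur.
Qed.

Definition flows_on : {set {ffun edge G -> B}} :=
  [set f | is_flow f && (supp f \subset A)].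

(** Image times kernel is counted for [component_sum] and for [boundary]; the kernel of the first is
    the image of the second. The product form avoids truncated subtraction. *)
Lemma card_flows_on_mul :
  (#|B| ^ #|vertex G| * #|flows_on| = #|B| ^ ncomp A * #|B| ^ #|A|)%N.
Proof.
have -> : (#|B| ^ #|vertex G| = #|[set: {ffun vertex G -> B}]|)%N.
  by rewrite cardsT card_ffun.
rewrite (card_additive_image _ _ component_sumD); try by move=> *; rewrite in_setT.
rewrite component_sum_image card_root_supported -card_supported.
rewrite (card_additive_image supportedD supportedN boundaryD) boundary_image.
rewrite mulnA; congr (_ * _)%N; apply: eq_card => f.
by rewrite !inE is_flowE andbC.
Qed.

Lemma card_flows_on : #|flows_on| = (#|B| ^ gnullity A)%N.
Proof.
have B0 : (0 < #|B|)%N by apply/card_gt0P; exists 0.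
have V0 : (ncomp A <= #|vertex G|)%N := ncomp_leq A.
have F0 : (0 < #|flows_on|)%N.
  apply/card_gt0P; exists 0; rewrite inE; apply/andP; split.
    by apply/forallP => v; rewrite !big1 ?subrr // => e _; rewrite ffunE.
  by apply/subsetP => e; rewrite inE ffunE eqxx.
have E : (#|B| ^ grank A * #|flows_on| = #|B| ^ #|A|)%N.
  apply/eqP; rewrite -(eqn_pmul2l (m := (#|B| ^ ncomp A)%N)) ?expn_gt0 ?B0 //.
  by rewrite mulnA -expnD /grank subnKC // card_flows_on_mul.
(* Exponents can be compared only when [#|B| > 1]; there [E] itself yields [grank A <= #|A|], so the
   subtraction in [gnullity] is exact. For the trivial group both sides are 1. *)
case: (ltngtP #|B| 1) => [|B1|B1].
- by rewrite ltnS leqNgt B0.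
- have le : (grank A <= #|A|)%N.
    by rewrite -(leq_exp2l _ _ B1) -E leq_pmulr.
  apply/eqP; rewrite -(eqn_pmul2l (m := (#|B| ^ grank A)%N)) ?expn_gt0 ?B0 //.
  by rewrite E -expnD /gnullity subnKC.
- by move: E; rewrite B1 !exp1n mul1n.
Qed.

End FlowCount.

(** * Potentials and their coboundaries *)

Section Potentials.

Variables (G : ograph) (B : finZmodType).
Implicit Types (A : {set edge G}) (p : {ffun vertex G -> B}) (t : {ffun edge G -> B}).
Implicit Types (h : edge G * bool) (w : seq (edge G * bool)).

Definition coboundary p : {ffun edge G -> B} := [ffun e => p (tgt e) - p (src e)].

Lemma coboundaryD : {morph coboundary : p q / p + q}.
Proof. by move=> p q; apply/ffunP => e; rewrite !ffunE opprD addrACA. Qed.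

(** The edgewise form makes the case [A = setT] literally the kernel of [coboundary]. *)
Definition locally_constant (A : {set edge G}) : {set {ffun vertex G -> B}} :=
  [set p : {ffun vertex G -> B} | [forall e in A, p (src e) == p (tgt e)]].

Lemma locally_constantP (A : {set edge G}) p :
  reflect {in A, forall e, p (src e) = p (tgt e)} (p \in locally_constant A).
Proof.
rewrite inE; apply: (iffP forallP) => [h e eA|h e].
  by have /implyP/(_ eA)/eqP := h e.
by apply/implyP => /h ->.
Qed.

Lemma locally_constant_root A p v :
  p \in locally_constant A -> p (fingraph.root (adj A) v) = p v.
Proof.
move/locally_constantP => pA.
have /connectP[s] := connect_root (adj A) v.
move=> pth ->; elim: s v pth => [//|w s IH] v /= /andP[+ /IH ->].
by case/existsP => e /andP[/pA pe /orP[]/andP[/eqP<- /eqP<-]].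
Qed.

(** Values at the roots are arbitrary and determine the potential: [ext] spreads them over the
    components. *)
Lemma card_locally_constant A : #|locally_constant A| = (#|B| ^ ncomp A)%N.
Proof.
rewrite -card_root_supported.
pose ext (g : {ffun vertex G -> B}) := [ffun v => g (fingraph.root (adj A) v)].
have cs := adj_connect_sym A.
have g0 g v : g \in root_supported A B -> v \notin roots (adj A) -> g v = 0.
  rewrite inE => /forallP/(_ v)/implyP gs; apply: contraNeq => /gs //.
have inj : {in root_supported A B &, injective ext}.
  move=> g g' gA g'A /ffunP E; apply/ffunP => v.
  case: (boolP (v \in roots (adj A))) => [/eqP rv|nv]; last by rewrite !g0.
  by have := E v; rewrite !ffunE rv.
rewrite -(card_in_imset inj); congr #|pred_of_set _|.
apply/setP => p; apply/idP/imsetP => [pA|[g _ ->]]; last first.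
  by apply/locally_constantP => e eA; rewrite !ffunE root_edge.
exists [ffun v => if v \in roots (adj A) then p v else 0].
  by rewrite inE; apply/forallP => v; rewrite ffunE; case: ifP; rewrite ?eqxx ?implybT.
have rr v : fingraph.root (adj A) v \in roots (adj A) := roots_root cs v.
by apply/ffunP => v; rewrite !ffunE rr locally_constant_root.
Qed.

Lemma signed_sumE t (C M : {set edge G}) : M \subset C ->
  \sum_(e in C :\: M) t e - \sum_(e in M) t e
    = \sum_(e in C) (if e \in M then - t e else t e).
Proof.
move=> MC; rewrite [RHS](big_setID M) /= (setIidPr MC) [LHS]addrC -sumrN.
congr (_ + _); apply: eq_bigr => e; first by move=> ->.
by rewrite inE => /andP[/negPf->].
Qed.

Lemma coboundary_tension p : is_tension (coboundary p).
Proof.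
apply/forallP => C; apply/forallP => M; apply/implyP => /andP[MC].
rewrite signed_sumE // => /andP[_ /existsP[s /and3P[/eqP sC us cs]]].
have us' : uniq s := map_uniq us.
(* Reversing an edge negates its potential difference, so the signs disappear in [reverse M]. *)
have -> : \sum_(e in C) (if e \in M then - coboundary p e else coboundary p e) =
    \sum_(e <- s) (p (@tgt (reverse M) e) - p (@src (reverse M) e)).
  rewrite [RHS]big_uniq //=; apply: eq_big => [e|e _]; first by move/setP/(_ e): sC; rewrite inE.
  by rewrite ffunE; case: ifP; rewrite ?opprB.
rewrite sumrB subr_eq0; apply/eqP.
rewrite -(big_map (@tgt (reverse M)) predT p) -(big_map (@src (reverse M)) predT p).
suff -> : map (@tgt (reverse M)) s = rot 1 (map (@src (reverse M)) s).
  by apply: perm_big; rewrite perm_rot.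
exact: cycle_map_rot1.
Qed.

(** * Walks and sums of tensions along them *)

(* [(e, false)] traverses [e] forwards and [(e, true)] backwards. *)
Definition hsrc h := if h.2 then tgt h.1 else src h.1.
Definition htgt h := if h.2 then src h.1 else tgt h.1.
Definition hval t h := if h.2 then - t h.1 else t h.1.

Fixpoint walk (u v : vertex G) w : bool :=
  if w is h :: w' then (hsrc h == u) && walk (htgt h) v w' else u == v.

Lemma walk_cat u v w w' :
  walk u v (w ++ w') = [exists x, walk u x w && walk x v w'].
Proof.
elim: w u => [|h w IH] u /=.
  apply/idP/existsP => [uv|[x /andP[/eqP -> //]]].
  by exists u; rewrite eqxx.
rewrite IH; apply/andP/existsP => [[hu /existsP[x]]|[x /andP[/andP[hu hw] hw']]].
  by exists x; rewrite hu.
by split=> //; apply/existsP; exists x; rewrite hw.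
Qed.

Definition hrev h := (h.1, ~~ h.2).

Lemma walk_rev u v w : walk u v w -> walk v u (rev (map hrev w)).
Proof.
elim: w u => [|h w IH] u /=; first by rewrite eq_sym.
case/andP=> /eqP <- /IH hw; rewrite rev_cons -cats1 walk_cat.
apply/existsP; exists (htgt h); rewrite hw /=.
by case: h {hw} => e []; rewrite /hsrc /htgt /= !eqxx.
Qed.

Lemma sum_hval_rev t w :
  \sum_(h <- rev (map hrev w)) hval t h = - \sum_(h <- w) hval t h.
Proof.
rewrite (perm_big (map hrev w)) ?perm_rev //= big_map -sumrN.
by apply: eq_bigr => -[e []] _; rewrite /hval /= ?opprK.
Qed.

Lemma walk_cycle u w : walk u u w ->
  cycle [rel h h' | htgt h == hsrc h'] w.
Proof.
case: w => [//|h w] /= /andP[/eqP <-].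
(* Only the current half-edge is generalised; the one that closes the cycle remains [h]. *)
elim: w {1 3}h => [|h' w IH] h0 /=; first by rewrite andbT.
by case/andP=> /eqP -> /IH ->; rewrite eqxx.
Qed.

(** Reversing the backward edges [M] turns the walk into a directed cycle on its edge set [C].
    Distinct start vertices alone would still admit an edge followed by its own reverse. *)
Lemma simple_closed_walk_sum t u w : is_tension t -> w != [::] -> walk u u w ->
  uniq (map hsrc w) -> uniq (map fst w) -> \sum_(h <- w) hval t h = 0.
Proof.
move=> tt w0 wu usrc ufst.
pose s := map fst w; pose C := [set e in s].
pose M := [set e | (e, true) \in w].
(* As no edge is repeated, each one occurs in a single direction, which [M] records. *)
have inM : {in w, forall h, (h.1 \in M) = h.2}.
  move=> [e b] hw; rewrite inE /=; apply/idP/idP => [|bt]; last by rewrite bt in hw.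
  move=> hw'; have sameh : (e, true) = (e, b).
    suff : {in w &, injective fst} by apply.
    exact: uniq_map_inj_in.
  by case: sameh => <-.
have MC : M \subset C.
  by apply/subsetP => e; rewrite !inE => ew; apply/mapP; exists (e, true).
have srcE : {in w, forall h, @src (reverse M) h.1 = hsrc h}.
  by move=> h hw; rewrite /= inM.
have tgtE : {in w, forall h, @tgt (reverse M) h.1 = htgt h}.
  by move=> h hw; rewrite /= inM.
have sz : size s == #|C|.
  by rewrite cardsE; apply/eqP/esym/card_uniqP.
have dC : @directed_cycle (reverse M) C.
  apply/andP; split.
    case: (w) w0 @s @C {MC sz} => [//|h w'] _ s C.
    by apply/set0Pn; exists h.1; rewrite !inE eqxx.
  apply/existsP; exists (Tuple sz); rewrite eqxx /=; apply/andP; split.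
    rewrite -map_comp (_ : map _ w = map hsrc w) //.
    by apply/eq_in_map => h /srcE.
  rewrite /s cycle_map.
  rewrite (eq_in_cycle (P := mem w) (e' := [rel h h' | htgt h == hsrc h'])) ?(walk_cycle wu) //.
  by move=> h h' hw h'w; rewrite /= -[RHS]/(_ == _) -(srcE h') // -(tgtE h).
have /forallP/(_ C)/forallP/(_ M) := tt.
rewrite MC dC signed_sumE //= => /eqP E; rewrite -[RHS]E.
rewrite (eq_bigl (fun e => e \in s)) => [|e]; last by rewrite inE.
rewrite -big_uniq //= big_map big_seq [RHS]big_seq; apply: eq_bigr => h hw.
by rewrite inM.
Qed.

(* A walk repeating a vertex splits into two shorter closed walks; one repeating
   an edge but no vertex contains an immediate backtrack, which can be erased. *)
Lemma closed_walk_sum t u w : is_tension t -> walk u u w ->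
  \sum_(h <- w) hval t h = 0.
Proof.
move=> tt; have [n] := ubnP (size w); elim: n u w => // n IH u w.
rewrite ltnS => szw wu.
case: (boolP (uniq (map hsrc w))) => [usrc|]; last first.
  case/not_uniq_map_split => w1 [h1 [w2 [h2 [w3 [E h12]]]]].
  move: wu; rewrite E walk_cat => /existsP[x /andP[W1]].
  rewrite -cat_cons walk_cat => /existsP[y /andP[W2 W3]].
  have xE : hsrc h1 = x by case/andP: W2 => /eqP.
  have yE : hsrc h2 = y by case/andP: W3 => /eqP.
  have exy : y = x by rewrite -xE h12.
  subst y; rewrite exy in W2 W3.
  (* The closed walk [h1 :: w2] at [x] is excised, leaving the closed walk [w1 ++ h2 :: w3] at
     [u]. *)
  rewrite !big_cat /= addrCA -big_cat /=.
  rewrite (IH x (h1 :: w2)) //; last first.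
    by apply: leq_trans szw; rewrite E !size_cat /= size_cat /=; lia.
  rewrite (IH u (w1 ++ h2 :: w3)) ?addr0 //.
    by apply: leq_trans szw; rewrite E !size_cat /= size_cat /=; lia.
  by rewrite walk_cat; apply/existsP; exists x; rewrite W1.
case: (boolP (uniq (map fst w))) => [ufst|].
  case: w wu usrc ufst {szw} => [|h w]; first by rewrite big_nil.
  by move=> wu usrc ufst; apply: (simple_closed_walk_sum tt _ wu).
case/not_uniq_map_split => w1 [h1 [w2 [h2 [w3 [E h12]]]]].
move: wu usrc; rewrite E walk_cat => /existsP[x /andP[W1 /= /andP[/eqP xE]]].
rewrite map_cat cat_uniq /= map_cat /= => W2 /and3P[_ _ /andP[n1]].
(* Traversing the edge twice in the same direction would repeat its start vertex. *)
have h2E : h2 = hrev h1.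
  case: h1 h2 h12 {xE W2 E} n1 => [e b] [e' b'] /= <-.
  by rewrite mem_cat inE !negb_or /hrev /hsrc /=; case: b; case: b';
    rewrite //= eqxx ?andbF.
have tE : hsrc h2 = htgt h1 by rewrite h2E /hsrc /htgt /=; case: h1.2.
have sE : htgt h2 = hsrc h1 by rewrite h2E /hsrc /htgt /=; case: h1.2.
(* A nonempty [w2] would begin at [htgt h1], which is also the start of [h2]: a repeated vertex. *)
case: w2 E W2 n1 => [|h' w2] E /=; last first.
  case/andP=> /eqP h'E _ _; rewrite h'E -tE mem_cat inE eqxx !orbT.
  by rewrite andFb.
case/andP=> _; rewrite sE xE => W3 _ _.
rewrite big_cat !big_cons /= addrCA [X in _ + X]addrCA addrA -big_cat /=.
rewrite (IH u (w1 ++ w3)).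
- by rewrite h2E /hval /=; case: h1.2; rewrite ?addNr ?subrr addr0.
- by apply: leq_trans szw; rewrite E !size_cat /=; lia.
by rewrite walk_cat; apply/existsP; exists x; rewrite W1.
Qed.

Lemma root_walk (v : vertex G) :
  exists w, walk (fingraph.root (adj [set: edge G]) v) v w.
Proof.
have: connect (adj [set: edge G]) (fingraph.root (adj setT) v) v.
  by rewrite adj_connect_sym connect_root.
case/connectP => s; elim: s (fingraph.root _ _) => [|x s IH] u /=.
  by move=> _ ->; exists [::]; rewrite /= eqxx.
case/andP=> /existsP[e /andP[_ ends]] /IH{}IH /IH[w W].
case/orP: ends => /andP[/eqP su /eqP tx].
  by exists ((e, false) :: w); rewrite /= /hsrc /htgt /= su eqxx tx.
by exists ((e, true) :: w); rewrite /= /hsrc /htgt /= su tx eqxx.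
Qed.

(* Integrate t along a chosen walk from the root of each component. *)
Lemma tension_coboundary t : is_tension t -> exists p, t = coboundary p.
Proof.
move=> tt; pose r v := fingraph.root (adj [set: edge G]) v.
pose W v := xchoose (root_walk v).
exists [ffun v => \sum_(h <- W v) hval t h]; apply/ffunP => e; rewrite !ffunE.
apply/eqP; rewrite eq_sym subr_eq -subr_eq0 opprD addrA -sum_hval_rev.
(* From the root to [tgt e], back across [e], then home from [src e]; both ends of [e] have the same
   root, so this walk is closed. *)
pose w := W (tgt e) ++ (e, true) :: rev (map hrev (W (src e))).
suff /(closed_walk_sum tt) : walk (r (tgt e)) (r (tgt e)) w.
  by rewrite big_cat big_cons /= addrA => /eqP.
rewrite walk_cat; apply/existsP; exists (tgt e).
rewrite (xchooseP (root_walk (tgt e))) /= /hsrc /htgt /= eqxx /=.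
apply: walk_rev; rewrite /r -root_edge ?inE //.
exact: (xchooseP (root_walk (src e))).
Qed.

(** * Counting tensions that vanish on [A] *)

Definition tensions_off (A : {set edge G}) : {set {ffun edge G -> B}} :=
  [set t | is_tension t && [disjoint A & supp t]].

Lemma coboundary_image A : coboundary @: locally_constant A = tensions_off A.
Proof.
apply/setP => t; rewrite inE; apply/imsetP/andP => [[p pA ->]|[tt dis]].
  split; first exact: coboundary_tension.
  rewrite disjoint_subset; apply/subsetP => e eA; rewrite !inE ffunE negbK.
  by move/locally_constantP: pA => ->; rewrite ?subrr.
have [p tE] := tension_coboundary tt; exists p => //.
apply/locally_constantP => e eA.
have := disjointFr dis eA; rewrite inE tE ffunE => /negbFE.
by rewrite subr_eq0 => /eqP ->.
Qed.

(** On potentials constant on the components of [(V, A)], the kernel of [coboundary] consists of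
    those constant on the components of [G]; the exponent is the difference of the two component
    counts. *)
Lemma card_tensions_off A :
  #|tensions_off A| = (#|B| ^ (grank [set: edge G] - grank A))%N.
Proof.
have B0 : (0 < #|B|)%N by apply/card_gt0P; exists 0.
have E : (#|B| ^ ncomp A = #|tensions_off A| * #|B| ^ ncomp [set: edge G])%N.
  rewrite -!card_locally_constant -coboundary_image.
  rewrite (card_additive_image _ _ coboundaryD).
  - congr (_ * _)%N; apply: eq_card => p.
    rewrite inE; apply/andP/idP => [[_ /eqP/ffunP c0]|pT].
      apply/locally_constantP => e _; apply/esym/eqP; rewrite -subr_eq0.
      by have := c0 e; rewrite !ffunE => ->.
    move/locally_constantP: pT => pT; split.
      by apply/locally_constantP => e _; apply: pT; rewrite inE.
    by apply/eqP/ffunP => e; rewrite !ffunE pT ?inE ?subrr.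
  - move=> p q /locally_constantP pA /locally_constantP qA.
    by apply/locally_constantP => e eA; rewrite !ffunE pA ?qA.
  - move=> p /locally_constantP pA.
    by apply/locally_constantP => e eA; rewrite !ffunE pA.
have F0 : (0 < #|tensions_off A|)%N.
  by have := expn_gt0 #|B| (ncomp A); rewrite B0 E; case: #|tensions_off A|.
have Vl := ncomp_leq A.
(* For [#|B| > 1] the count gives [ncomp setT <= ncomp A]; with [Vl] this makes the truncated rank
   differences exact. *)
case: (ltngtP #|B| 1) => [|B1|B1].
- by rewrite ltnS leqNgt B0.
- have le : (ncomp [set: edge G] <= ncomp A)%N.
    by rewrite -(leq_exp2l _ _ B1) E leq_pmull.
  apply/eqP; rewrite -(eqn_pmul2r (m := (#|B| ^ ncomp [set: edge G])%N)) ?expn_gt0 ?B0 //.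
  rewrite -E -expnD; apply/eqP; congr (_ ^ _)%N; rewrite /grank.
  lia.
- by move: E; rewrite B1 !exp1n muln1.
Qed.

End Potentials.

(** * Regrouping the triples by edge set *)

Section Triples.

Variables (G : ograph) (B D : finZmodType).

(** For [A = supp f :|: sigma], the conditions on the triple amount to [supp f \subset A] and [A]
    disjoint from [supp t]; [sigma] is recovered as [A :\: supp f]. *)
Lemma card_triples :
  #|[set x : {ffun edge G -> B} * {ffun edge G -> D} * {set edge G} |
      let: (f, t, sigma) := x in
      [&& is_flow f, is_tension t, [disjoint supp f & supp t]
        & sigma \subset ~: (supp f :|: supp t)]]|
  = (\sum_(A : {set edge G}) #|flows_on B A| * #|tensions_off D A|)%N.
Proof.
set S := [set _ | _].
pose T := [set x : {ffun edge G -> B} * {ffun edge G -> D} * {set edge G} |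
   (x.1.1 \in flows_on B x.2) && (x.1.2 \in tensions_off D x.2)].
pose phi (x : {ffun edge G -> B} * {ffun edge G -> D} * {set edge G}) :=
  (x.1, supp x.1.1 :|: x.2).
have phi_inj : {in S &, injective phi}.
  have sig (f : {ffun edge G -> B}) (t : {ffun edge G -> D}) (s : {set edge G}) :
      (f, t, s) \in S -> s = (supp f :|: s) :\: supp f.
    rewrite inE => /and4P[_ _ _ /subsetP h]; apply/setP => e; rewrite in_setD in_setU.
    case: (boolP (e \in s)) => [/h|_]; last by rewrite orbF andNb.
    by rewrite !in_setC in_setU negb_or => /andP[-> _]; rewrite orbT.
  move=> [[f t] s] [[f' t'] s'] /sig sE /sig s'E [ff tt' E].
  by rewrite sE s'E -ff -tt' E ff.
transitivity #|T|.
  rewrite -(card_in_imset phi_inj); congr #|pred_of_set _|.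
  apply/setP => -[[f t] A]; apply/imsetP/idP => [[[[f' t'] s]]|].
    rewrite inE => /and4P[hf ht dis /subsetP ss] [-> -> ->].
    rewrite !inE /= hf ht subsetUl /= disjoint_sym disjoints_subset.
    apply/subsetP => e et; rewrite in_setC in_setU negb_or.
    rewrite (disjointFl dis et) /=; apply/negP => /ss.
    by rewrite in_setC in_setU et orbT.
  rewrite !inE /= => /andP[/andP[hf fA] /andP[ht At]].
  exists (f, t, A :\: supp f); last by rewrite /phi /= setDE setUIr setUCr setIT (setUidPr fA).
  rewrite inE hf ht (disjointWl fA At) /=; apply/subsetP => e.
  rewrite in_setD in_setC in_setU negb_or => /andP[-> eA].
  by rewrite (disjointFr At eA).
(* The fibre of [T] over [A] is a product of a set of flows and a set of tensions. *)
rewrite -sum1_card (partition_big snd predT) //=; apply: eq_bigr => A _.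
rewrite -cardsX sum1dep_card -[RHS](card_imset _ (_ : injective (fun ft => (ft, A)))); last by move=> ? ? [].
apply: eq_card => -[[f t] A']; rewrite inE; apply/andP/imsetP => [[]|].
  rewrite inE /= => /andP[fA tA] /eqP A'A; rewrite A'A in fA tA *; exists (f, t) => //.
  by rewrite in_setX fA.
by case=> -[f' t']; rewrite in_setX => /andP[fA tA] [-> -> ->]; rewrite inE fA tA eqxx.
Qed.

End Triples.

Theorem theorem5p1 (G : ograph) (k l : nat) (hk : (0 < k)%N) (hl : (0 < l)%N) :
  (tutte G).[1 + l%:R, 1 + k%:R] =
  #|[set x : {ffun edge G -> Zmod k} * {ffun edge G -> Zmod l} * {set edge G} |
      let: (f, t, sigma) := x in
      [&& is_flow f, is_tension t, [disjoint supp f & supp t]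
        & sigma \subset ~: (supp f :|: supp t)]]|%:R :> int.
Proof.
rewrite card_triples natr_sum /tutte !horner_sum; apply: eq_bigr => A _.
(* Positivity of [k] and [l] enters through [prednK]: the groups have orders exactly [k] and [l],
   the values of ['Y - 1] and ['X - 1]. *)
rewrite card_flows_on card_tensions_off !card_ord !prednK //.
by rewrite natrM !natrX !hornerE !(addrC 1) !addrK mulrC.
Qed.
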